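(* (Formula of $(p,q)$-integration by parts) Suppose that $f(x)$ and $g(x)$ are two functions whose ordinary derivatives exist in a neighbourhood of $x=0$. Then, for $0\le a<b\le\infty$ (the value $b=\infty$ is allowed), $$\int_a^b f(px)\left(D_{p,q} g(x)\right)d_{p,q} x=f(b)g(b)-f(a)g(a)-\int_a^b g(qx)\left(D_{p,q} f(x)\right)d_{p,q} x.$$
   Context: Here $p\neq q$ are numbers to which the definitions below apply. The $(p,q)$-derivative is $D_{p,q}f(x)=\dfrac{f(px)-f(qx)}{(p-q)x}$ for $x\neq0$, and $(D_{p,q}f)(0)=f'(0)$ provided $f$ is differentiable at $0$. For a function $h$ and a real number $a$, the definite $(p,q)$-integral is $$\int_0^a h(x)\,d_{p,q}x=(q-p)a\sum_{k=0}^\infty \frac{p^k}{q^{k+1}}h\left(\frac{p^k}{q^{k+1}}a\right)\ \text{ if } \left|\frac pq\right|<1,\qquad \int_0^a h(x)\,d_{p,q}x=(p-q)a\sum_{k=0}^\infty \frac{q^k}{p^{k+1}}h\left(\frac{q^k}{p^{k+1}}a\right)\ \text{ if } \left|\frac pq\right|>1,$$ and for finite $0\le a<b$, $\int_a^b h(x)\,d_{p,q}x=\int_0^b h(x)\,d_{p,q}x-\int_0^a h(x)\,d_{p,q}x$. The improper $(p,q)$-integral on $[0,\infty)$ is $$\int_0^\infty h(x)\,d_{p,q}x=(p-q)\sum_{j=-\infty}^\infty \frac{q^j}{p^{j+1}}h\left(\frac{q^j}{p^{j+1}}\right)\ \text{ if } 0<\frac qp<1,\qquad \int_0^\infty h(x)\,d_{p,q}x=(q-p)\sum_{j=-\infty}^\infty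 \frac{p^j}{q^{j+1}}h\left(\frac{p^j}{q^{j+1}}\right)\ \text{ if } \frac qp>1.$$ For $a>0$, $$\int_a^\infty h(x)\,d_{p,q}x=(q-p)a\sum_{k=0}^\infty \frac{p^{-(k+1)}}{q^{-k}}h\left(\frac{p^{-(k+1)}}{q^{-k}}a\right)\ \text{ if } \left|\frac pq\right|<1,\qquad \int_a^\infty h(x)\,d_{p,q}x=(p-q)a\sum_{k=0}^\infty \frac{q^{-(k+1)}}{p^{-k}}h\left(\frac{q^{-(k+1)}}{p^{-k}}a\right)\ \text{ if } \left|\frac pq\right|>1.$$ When $b=\infty$, $f(b)g(b)$ denotes $\lim_{x\to\infty}f(x)g(x)$. *)

(* Defs.v *)
From Stdlib Require Import Reals ZArith.
From Coquelicot Require Import Coquelicot.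

Local Open Scope R_scope.

Definition Dpq (p q : R) (f : R -> R) (x : R) : R :=
  if Req_EM_T x 0 then Derive f 0
  else (f (p * x) - f (q * x)) / ((p - q) * x).

(** Each integral is a sum of weighted samples [c * h (c * a)]; as for
    Coquelicot's [RInt] and [ex_RInt], the value is a total function and
    convergence is a separate predicate.  The values at [Rabs (p / q) = 1],
    where no integral is defined, are junk.  The suffix [0] stands for the
    integral from [0] to [a], [_tail] for the one from [a > 0] to infinity, and
    [_line] for the one from [0] to infinity, meaningful when [0 < q / p]. *)

Definition pq_term (h : R -> R) (a c : R) : R := c * h (c * a).

Definition pq_nodes0 (p q : R) (k : nat) : R :=
  if Rlt_dec (Rabs (p / q)) 1 then p ^ k / q ^ (k + 1) else q ^ k / p ^ (k + 1).

Definition ex_pqint0 (p q : R) (h : R -> R) (a : R) : Prop :=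
  ex_series (fun k => pq_term h a (pq_nodes0 p q k)).

Definition pqint0 (p q : R) (h : R -> R) (a : R) : R :=
  (if Rlt_dec (Rabs (p / q)) 1 then q - p else p - q) * a *
  Series (fun k => pq_term h a (pq_nodes0 p q k)).

Definition pq_nodes_tail (p q : R) (k : nat) : R :=
  if Rlt_dec (Rabs (p / q)) 1
  then powerRZ p (- (Z.of_nat k + 1)) / powerRZ q (- Z.of_nat k)
  else powerRZ q (- (Z.of_nat k + 1)) / powerRZ p (- Z.of_nat k).

Definition ex_pqint_tail (p q : R) (h : R -> R) (a : R) : Prop :=
  ex_series (fun k => pq_term h a (pq_nodes_tail p q k)).

Definition pqint_tail (p q : R) (h : R -> R) (a : R) : R :=
  (if Rlt_dec (Rabs (p / q)) 1 then q - p else p - q) * a *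
  Series (fun k => pq_term h a (pq_nodes_tail p q k)).

(** A bilateral series converges when both of its halves, [0 <= j] and
    [j < 0], converge. *)
Definition ex_bseries (u : Z -> R) : Prop :=
  ex_series (fun n => u (Z.of_nat n)) /\
  ex_series (fun n => u (- Z.of_nat (S n))%Z).

Definition BSeries (u : Z -> R) : R :=
  Series (fun n => u (Z.of_nat n)) + Series (fun n => u (- Z.of_nat (S n))%Z).

Definition pq_nodes_line (p q : R) (j : Z) : R :=
  if Rlt_dec (q / p) 1 then powerRZ q j / powerRZ p (j + 1)
  else powerRZ p j / powerRZ q (j + 1).

Definition ex_pqint_line (p q : R) (h : R -> R) : Prop :=
  ex_bseries (fun j => pq_term h 1 (pq_nodes_line p q j)).

Definition pqint_line (p q : R) (h : R -> R) : R :=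
  (if Rlt_dec (q / p) 1 then p - q else q - p) *
  BSeries (fun j => pq_term h 1 (pq_nodes_line p q j)).

Definition ex_pqint (p q : R) (h : R -> R) (a : R) (b : Rbar) : Prop :=
  match b with
  | Finite b => ex_pqint0 p q h b /\ ex_pqint0 p q h a
  | p_infty => if Req_EM_T a 0 then ex_pqint_line p q h else ex_pqint_tail p q h a
  | m_infty => False
  end.

Definition pqint (p q : R) (h : R -> R) (a : R) (b : Rbar) : R :=
  match b with
  | Finite b => pqint0 p q h b - pqint0 p q h a
  | p_infty => if Req_EM_T a 0 then pqint_line p q h else pqint_tail p q h a
  | m_infty => 0
  end.

(** The pairs [p], [q] for which the integral from [a] to [b] is defined.  For
    finite [b] the value [p = 0] is meaningful (with [0 ^ 0 = 1]); the negative
    powers of [p] in the improper integrals rule it out when [b] is infinite. *)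
Definition pq_admissible (p q a : R) (b : Rbar) : Prop :=
  q <> 0 /\ Rabs (p / q) <> 1 /\
  (b = p_infty -> p <> 0) /\
  (b = p_infty -> a = 0 -> 0 < q / p).

Definition value_at (F : R -> R) (b : Rbar) : R :=
  match b with
  | Finite b => F b
  | _ => real (Lim F b)
  end.

(* Main.v *)
Require Import Defs.
From Stdlib Require Import Reals ZArith Lra Lia FunctionalExtensionality.
From Coquelicot Require Import Coquelicot.

Local Open Scope R_scope.

(** Writing [F = f * g], the two integrands add up to the [(p,q)]-derivative of
    [F], whose integral telescopes along the geometric nodes.  The two integrals
    over [[0, a]] converge separately because differentiability at [0] keeps
    both integrands bounded there.  Exchanging [p] with [q] and [f] with [g]
    exchanges the two integrands, so one may assume [Rabs (p / q) < 1]; and the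
    integral over the half-line is then the sum of the integrals from [0] to [1]
    and from [1] to infinity. *)

(** * Telescoping series *)

Lemma sum_n_telescope (u : nat -> R) (n : nat) :
  sum_n (fun k => u (S k) - u k) n = u (S n) - u 0%nat.
Proof.
  induction n as [|n IH].
  - now rewrite sum_O.
  - rewrite sum_Sn, IH; unfold plus; simpl; ring.
Qed.

Lemma is_series_telescope (u : nat -> R) (l : R) :
  is_lim_seq u l -> is_series (fun k => u (S k) - u k) (l - u 0%nat).
Proof.
  intros Hu.
  change (is_lim_seq (sum_n (fun k => u (S k) - u k)) (l - u 0%nat)).
  apply is_lim_seq_ext with (fun n => u (S n) - u 0%nat).
  - intros n; now rewrite sum_n_telescope.
  - apply is_lim_seq_minus'; [now apply -> is_lim_seq_incr_1 | apply is_lim_seq_const].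
Qed.

(** The partial sums are [u (S n) - u 0], so summability forces [u] to converge. This serves the
    case [q / p < 0], where the limit of [u] cannot be read off directly. *)
Lemma ex_series_telescope_inv (u : nat -> R) :
  ex_series (fun k => u (S k) - u k) -> ex_finite_lim_seq u.
Proof.
  intros [l Hl]; exists (l + u 0%nat).
  change (is_lim_seq (sum_n (fun k => u (S k) - u k)) l) in Hl.
  apply is_lim_seq_incr_1.
  apply is_lim_seq_ext with (fun n => sum_n (fun k => u (S k) - u k) n + u 0%nat).
  - intros n; rewrite sum_n_telescope; ring.
  - apply is_lim_seq_plus'; [exact Hl | apply is_lim_seq_const].
Qed.

(** Passes convergence from one integral to the other once their sum is known to telescope. *)
Lemma ex_series_plus_cancel (u v : nat -> R) :
  ex_series (fun k => u k + v k) -> ex_series u -> ex_series v.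
Proof.
  intros Huv Hu.
  apply ex_series_ext with (fun k => (u k + v k) - u k).
  - intros n; change (u n + v n - u n = v n); ring.
  - exact (ex_series_minus _ _ Huv Hu).
Qed.

(** * Bounds near [0] from differentiability or continuity *)

Lemma ex_derive_lipschitz_0 (g : R -> R) :
  ex_derive g 0 ->
  exists M, 0 <= M /\ locally 0 (fun x => Rabs (g x - g 0) <= M * Rabs x).
Proof.
  intros [l Hg].
  apply is_derive_Reals in Hg.
  destruct (Hg 1 Rlt_0_1) as [d Hd].
  (* With tolerance [1], the difference quotient stays within [1] of the derivative [l]. *)
  exists (Rabs l + 1); split; [pose proof (Rabs_pos l); lra|].
  exists d; intros x Hx.
  unfold ball in Hx; simpl in Hx; unfold AbsRing_ball, abs, minus, plus, opp in Hx;
    simpl in Hx; rewrite Ropp_0, Rplus_0_r in Hx.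
  destruct (Req_dec x 0) as [->|Hx0].
  - rewrite Rminus_diag, Rabs_R0; lra.
  - specialize (Hd x Hx0 Hx); rewrite Rplus_0_l in Hd.
    replace (g x - g 0) with (((g x - g 0) / x) * x) by (field; exact Hx0).
    rewrite Rabs_mult; apply Rmult_le_compat_r; [apply Rabs_pos|].
    replace ((g x - g 0) / x) with (((g x - g 0) / x - l) + l) by ring.
    eapply Rle_trans; [apply Rabs_triang|]; lra.
Qed.

Lemma locally_0_scal (P : R -> Prop) (c : R) :
  locally 0 P -> locally 0 (fun x => P (c * x)).
Proof.
  intros HP.
  assert (Hc : continuous (fun x : R => c * x) 0)
    by (apply (ex_derive_continuous (fun x : R => c * x)); now auto_derive).
  apply (Hc P); now rewrite Rmult_0_r.
Qed.

Lemma continuous_locally_bounded (f : R -> R) (x0 : R) :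
  continuous f x0 -> locally x0 (fun x => Rabs (f x) <= Rabs (f x0) + 1).
Proof.
  intros Hf.
  assert (H := proj1 (filterlim_locally _ _) Hf (mkposreal 1 Rlt_0_1)).
  revert H; apply filter_imp; intros x Hx.
  unfold ball in Hx; simpl in Hx; unfold AbsRing_ball, abs, minus, plus, opp in Hx;
    simpl in Hx.
  replace (f x) with (f x0 + (f x + - f x0)) by ring.
  eapply Rle_trans; [apply Rabs_triang|]; lra.
Qed.

(** * The (p,q)-derivative *)

Section PQ.
Variables p q : R.

Lemma Dpq_sym (f : R -> R) : p <> q -> Dpq p q f = Dpq q p f.
Proof.
  intros Hpq; apply functional_extensionality; intros x; unfold Dpq.
  destruct (Req_EM_T x 0); [reflexivity|].
  field; repeat split; lra.
Qed.

(** Splitting [g (p * x) - g (q * x)] through [g 0] bounds it by a multiple of [Rabs x], which the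
    denominator absorbs. The value at [0] is covered by adding [Rabs (Derive g 0)] to the
    constant. *)
Lemma Dpq_locally_bounded (g : R -> R) :
  p <> q -> ex_derive g 0 ->
  exists M, 0 <= M /\ locally 0 (fun x => Rabs (Dpq p q g x) <= M).
Proof.
  intros Hpq Hg.
  destruct (ex_derive_lipschitz_0 g Hg) as [M [HM HL]].
  assert (Hd : 0 < Rabs (p - q)) by (apply Rabs_pos_lt; lra).
  set (K := M * (Rabs p + Rabs q) / Rabs (p - q)).
  assert (HK : 0 <= K).
  { apply Rmult_le_pos; [|left; now apply Rinv_0_lt_compat].
    apply Rmult_le_pos; [exact HM|].
    pose proof (Rabs_pos p); pose proof (Rabs_pos q); lra. }
  exists (K + Rabs (Derive g 0)); split; [pose proof (Rabs_pos (Derive g 0)); lra|].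
  generalize (filter_and _ _ (locally_0_scal _ p HL) (locally_0_scal _ q HL)).
  apply filter_imp; intros x [H1 H2]; unfold Dpq.
  destruct (Req_EM_T x 0) as [Hx|Hx]; [lra|].
  apply Rle_trans with K; [|pose proof (Rabs_pos (Derive g 0)); lra].
  assert (Hx' : 0 < Rabs x) by now apply Rabs_pos_lt.
  rewrite Rabs_div by (apply Rmult_integral_contrapositive_currified; lra).
  rewrite !Rabs_mult in *; unfold K.
  apply Rle_div_l; [now apply Rmult_lt_0_compat|].
  replace (M * (Rabs p + Rabs q) / Rabs (p - q) * (Rabs (p - q) * Rabs x))
    with (M * (Rabs p * Rabs x) + M * (Rabs q * Rabs x)) by (field; lra).
  replace (g (p * x) - g (q * x))
    with ((g (p * x) - g 0) + - (g (q * x) - g 0)) by ring.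
  eapply Rle_trans; [apply Rabs_triang|]; rewrite Rabs_Ropp; lra.
Qed.

(** At [c = 0], which is a node when [p = 0], both sides vanish. *)
Lemma pq_term_parts (f g : R -> R) (a c : R) :
  p <> q -> a <> 0 ->
  pq_term (fun x => f (p * x) * Dpq p q g x) a c +
  pq_term (fun x => g (q * x) * Dpq p q f x) a c =
  (f (p * c * a) * g (p * c * a) - f (q * c * a) * g (q * c * a)) / ((p - q) * a).
Proof.
  intros Hpq Ha; unfold pq_term, Dpq.
  rewrite !Rmult_assoc.
  destruct (Req_dec c 0) as [->|Hc].
  - rewrite !Rmult_0_l, !Rmult_0_r; unfold Rdiv; ring.
  - destruct (Req_EM_T (c * a) 0) as [H|H].
    + apply Rmult_integral in H; tauto.
    + field; repeat split; lra.
Qed.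

(** * Nodes and the integral from [0] when the ratio contracts *)

Hypothesis hq : q <> 0.
Hypothesis hr : Rabs (p / q) < 1.

(** In this form [p] times node [k] is visibly [q] times node [S k], which is what makes the sums
    telescope. *)
Lemma pq_nodes0E (k : nat) : pq_nodes0 p q k = (p / q) ^ k / q.
Proof.
  unfold pq_nodes0; destruct (Rlt_dec (Rabs (p / q)) 1); [|contradiction].
  unfold Rdiv; rewrite Rpow_mult_distr, pow_inv, pow_add, pow_1.
  field; split; [exact hq | now apply pow_nonzero].
Qed.

(** Here the nodes move outwards and the roles reverse: [q] times node [k] is [p] times node
    [S k]. *)
Lemma pq_nodes_tailE (k : nat) : p <> 0 -> pq_nodes_tail p q k = (q / p) ^ k / p.
Proof.
  intros hp; unfold pq_nodes_tail; destruct (Rlt_dec (Rabs (p / q)) 1); [|contradiction].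
  replace (Z.of_nat k + 1)%Z with (Z.of_nat (S k)) by lia.
  rewrite !powerRZ_neg', <- !pow_powerRZ.
  unfold Rdiv; rewrite Rpow_mult_distr, pow_inv; simpl.
  field; repeat split; try assumption; now apply pow_nonzero.
Qed.

Lemma is_lim_seq_pq_nodes (c : R) : is_lim_seq (fun k => (p / q) ^ k * c) 0.
Proof.
  replace 0 with (0 * c) by ring.
  apply is_lim_seq_mult'; [now apply is_lim_seq_geom | apply is_lim_seq_const].
Qed.

Lemma ex_pqint0_locally_bounded (h : R -> R) (a M : R) :
  locally 0 (fun x => Rabs (h x) <= M) -> ex_pqint0 p q h a.
Proof.
  intros Hh.
  (* Read as a filter limit, the convergence of the nodes to [0] gives a rank [N] from which the
     bound on [h] applies; the first [N] terms are then discarded and the rest compared with a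
     geometric series. *)
  assert (HN := is_lim_seq_pq_nodes (a / q) _ Hh).
  destruct HN as [N HN].
  apply (ex_series_incr_n _ N).
  apply (ex_series_le (V := R_CompleteNormedModule) _
           (fun k => Rabs (p / q) ^ k * (Rabs (p / q) ^ N * / Rabs q * M))).
  - intros k; change norm with Rabs; unfold pq_term.
    rewrite pq_nodes0E, Rabs_mult, Rabs_div, <- RPow_abs, pow_add by exact hq.
    specialize (HN (N + k)%nat ltac:(lia)).
    replace ((p / q) ^ (N + k) / q * a) with ((p / q) ^ (N + k) * (a / q))
      by (field; exact hq).
    unfold Rdiv at 1.
    replace (Rabs (p / q) ^ k * (Rabs (p / q) ^ N * / Rabs q * M))
      with (Rabs (p / q) ^ N * Rabs (p / q) ^ k * / Rabs q * M) by ring.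
    apply Rmult_le_compat_l; [|exact HN].
    repeat apply Rmult_le_pos; try (apply pow_le; apply Rabs_pos).
    left; apply Rinv_0_lt_compat; now apply Rabs_pos_lt.
  - apply ex_series_scal_r, ex_series_geom; now rewrite Rabs_Rabsolu.
Qed.

(** The scale [c] is free so as to cover both integrands, with [c = p] and [c = q]. *)
Lemma ex_pqint0_mult_Dpq (f g : R -> R) (c a : R) :
  p <> q -> continuous f 0 -> ex_derive g 0 ->
  ex_pqint0 p q (fun x => f (c * x) * Dpq p q g x) a.
Proof.
  intros Hpq Hf Hg.
  destruct (Dpq_locally_bounded g Hpq Hg) as [M [HM HD]].
  apply ex_pqint0_locally_bounded with ((Rabs (f 0) + 1) * M).
  generalize (filter_and _ _
    (locally_0_scal _ c (continuous_locally_bounded f 0 Hf)) HD).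
  apply filter_imp; intros x [H1 H2].
  rewrite Rabs_mult; apply Rmult_le_compat; auto using Rabs_pos.
Qed.

(** The added terms are increments of [f * g] along [(p / q) ^ k * a], divided by [(p - q) * a].
    They run from [a] down to [0], and the prefactor [(q - p) * a] restores the sign. *)
Lemma pqint0_parts (f g : R -> R) (a : R) :
  p <> q -> ex_derive f 0 -> ex_derive g 0 ->
  pqint0 p q (fun x => f (p * x) * Dpq p q g x) a +
  pqint0 p q (fun x => g (q * x) * Dpq p q f x) a = f a * g a - f 0 * g 0.
Proof.
  intros Hpq Hf Hg.
  assert (Cf := ex_derive_continuous _ _ Hf).
  assert (Cg := ex_derive_continuous _ _ Hg).
  unfold pqint0; destruct (Rlt_dec (Rabs (p / q)) 1); [|contradiction].
  (* At [a = 0] the prefactor kills both integrals; below, [(p - q) * a] is divided by. *)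
  destruct (Req_dec a 0) as [->|Ha]; [ring|].
  rewrite <- Rmult_plus_distr_l, <- Series_plus
    by now apply ex_pqint0_mult_Dpq.
  set (u k := f ((p / q) ^ k * a) * g ((p / q) ^ k * a)).
  assert (Hu : is_lim_seq u (f 0 * g 0)).
  { apply is_lim_seq_mult';
      (eapply filterlim_comp; [apply is_lim_seq_pq_nodes | assumption]). }
  rewrite (Series_ext _ (fun k => (u (S k) - u k) * / ((p - q) * a))).
  - rewrite Series_scal_r, (is_series_unique _ _ (is_series_telescope u _ Hu)).
    unfold u; rewrite pow_O, Rmult_1_l; field; split; lra.
  - intros k; rewrite pq_term_parts, pq_nodes0E by assumption; unfold u.
    replace (p * ((p / q) ^ k / q) * a) with ((p / q) ^ S k * a)
      by (simpl; field; exact hq).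
    replace (q * ((p / q) ^ k / q) * a) with ((p / q) ^ k * a)
      by (field; exact hq).
    reflexivity.
Qed.

(** * The integral from [a > 0] to infinity *)

(** Nothing bounds the integrands at infinity, so one convergence is assumed and the telescoping sum
    yields the other. If [q / p < 0], half of the nodes tend to minus infinity, out of reach of [L];
    both convergences are then assumed. *)
Lemma pqint_tail_parts (f g : R -> R) (a L : R) :
  let h1 := fun x => f (p * x) * Dpq p q g x in
  let h2 := fun x => g (q * x) * Dpq p q f x in
  p <> 0 -> p <> q -> 0 < a ->
  is_lim (fun x => f x * g x) p_infty L ->
  ex_pqint_tail p q h1 a \/ ex_pqint_tail p q h2 a ->
  (q / p < 0 -> ex_pqint_tail p q h1 a /\ ex_pqint_tail p q h2 a) ->
  ex_pqint_tail p q h1 a /\ ex_pqint_tail p q h2 a /\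
  pqint_tail p q h1 a + pqint_tail p q h2 a = L - f a * g a.
Proof.
  intros h1 h2 hp Hpq Ha HL Hor Hand.
  set (s := q / p).
  assert (Hs0 : s <> 0)
    by (apply Rmult_integral_contrapositive_currified; auto with real).
  assert (Hs : 1 < Rabs s).
  { unfold s; replace (q / p) with (/ (p / q)) by (field; auto).
    rewrite Rabs_inv, <- Rinv_1; apply Rinv_lt_contravar; [|exact hr].
    rewrite Rmult_1_r; apply Rabs_pos_lt.
    apply Rmult_integral_contrapositive_currified; auto with real. }
  set (u k := f (s ^ k * a) * g (s ^ k * a)).
  assert (Hterm : forall k,
    (u (S k) - u k) * / ((q - p) * a) =
    pq_term h1 a (pq_nodes_tail p q k) + pq_term h2 a (pq_nodes_tail p q k)).
  { intros k; unfold h1, h2; rewrite pq_term_parts, pq_nodes_tailE by lra.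
    unfold u; fold s.
    replace (p * (s ^ k / p) * a) with (s ^ k * a) by (field; exact hp).
    replace (q * (s ^ k / p) * a) with (s ^ S k * a)
      by (unfold s; simpl; field; exact hp).
    field; repeat split; lra. }
  (* Stated for any ratio [t] in order to serve [s] itself when positive, and [s ^ 2] along even
     indices when [s] is negative. *)
  assert (Hsub : forall (t : R) (v : nat -> R), 1 < t -> (forall k, v k = t ^ k * a) ->
            is_lim_seq (fun k => f (v k) * g (v k)) L).
  { intros t v Ht Hv.
    apply (is_lim_comp_seq (fun x => f x * g x) v p_infty L HL).
    - exists 0%nat; discriminate.
    - apply is_lim_seq_ext with (fun k => t ^ k * a); [intros k; now rewrite Hv|].
      eapply is_lim_seq_mult;
        [now apply is_lim_seq_geom_p | apply is_lim_seq_const|].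
      unfold is_Rbar_mult; simpl; destruct (Rle_dec 0 a) as [H|H]; [|lra].
      destruct (Rle_lt_or_eq_dec 0 a H); [reflexivity | lra]. }
  assert (Hu : is_lim_seq u L).
  { destruct (Rlt_or_le s 0) as [Hneg|Hpos].
    - (* The nodes change sign, so the limit of [f * g] controls only the even
         terms; that the whole sequence converges comes from the two series. *)
      destruct (Hand Hneg) as [E1 E2].
      destruct (ex_series_telescope_inv u) as [l Hl].
      { apply ex_series_ext with
          (fun k => (u (S k) - u k) * / ((q - p) * a) * ((q - p) * a)).
        - intros k.
          change ((u (S k) - u k) * / ((q - p) * a) * ((q - p) * a) = u (S k) - u k).
          field; split; lra.
        - apply ex_series_scal_r; eapply ex_series_ext;
            [intros k; symmetry; apply Hterm|].
          exact (ex_series_plus _ _ E1 E2). }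
      assert (Heven : is_lim_seq (fun k => u (2 * k)%nat) L).
      { apply (Hsub (s ^ 2)).
        - rewrite <- pow2_abs; nra.
        - intros k; now rewrite pow_mult. }
      assert (Heven' : is_lim_seq (fun k => u (2 * k)%nat) l).
      { apply (is_lim_seq_subseq u l (fun k => (2 * k)%nat)); [|exact Hl].
        apply eventually_subseq; intros k; lia. }
      apply is_lim_seq_unique in Heven; apply is_lim_seq_unique in Heven'.
      rewrite Heven in Heven'; injection Heven' as ->; exact Hl.
    - apply (Hsub s); [rewrite Rabs_pos_eq in Hs; lra | reflexivity]. }
  assert (Hsum := is_series_scal_r (/ ((q - p) * a)) _ _ (is_series_telescope u L Hu)).
  eapply is_series_ext in Hsum; [|exact Hterm].
  assert (Ex : ex_pqint_tail p q h1 a /\ ex_pqint_tail p q h2 a).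
  { destruct Hor as [E|E]; split; try exact E.
    - eapply ex_series_plus_cancel; [|exact E]; eexists; exact Hsum.
    - eapply ex_series_plus_cancel; [|exact E].
      eapply ex_series_ext; [intros k; apply Rplus_comm|]; eexists; exact Hsum. }
  destruct Ex as [E1 E2]; split; [exact E1 | split; [exact E2|]].
  unfold pqint_tail; destruct (Rlt_dec (Rabs (p / q)) 1); [|contradiction].
  rewrite <- Rmult_plus_distr_l, <- Series_plus by assumption.
  rewrite (is_series_unique _ _ Hsum).
  unfold u; rewrite pow_O, Rmult_1_l; field; split; lra.
Qed.

(** * Cutting the half-line at [1] *)

Hypothesis hqp : 0 < q / p.

(** Reconciles the test on [q / p] in the bilateral integral with the test on [Rabs (p / q)] in the
    other two. *)
Lemma one_lt_inv_ratio : 1 < q / p.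
Proof.
  assert (hp : p <> 0).
  (* Since [/ 0 = 0], the value [p = 0] would make [q / p] zero. *)
  { intros hp; rewrite hp in hqp; unfold Rdiv in hqp; rewrite Rinv_0 in hqp; lra. }
  assert (E : p / q * (q / p) = 1) by (field; auto).
  assert (0 < p / q).
  { replace (p / q) with (/ (q / p)) by (field; auto).
    now apply Rinv_0_lt_compat. }
  rewrite Rabs_pos_eq in hr; nra.
Qed.

Lemma pq_nodes_line_pos (n : nat) :
  pq_nodes_line p q (Z.of_nat n) = pq_nodes0 p q n.
Proof.
  pose proof one_lt_inv_ratio.
  unfold pq_nodes_line, pq_nodes0.
  destruct (Rlt_dec (q / p) 1); [lra|].
  destruct (Rlt_dec (Rabs (p / q)) 1); [|contradiction].
  now rewrite !pow_powerRZ, Nat2Z.inj_add.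
Qed.

(** At [j = - (n + 1)] the exponents of [p] and [q] are [- (n + 1)] and [- n], exactly those of tail
    node [n]. *)
Lemma pq_nodes_line_neg (n : nat) :
  pq_nodes_line p q (- Z.of_nat (S n)) = pq_nodes_tail p q n.
Proof.
  pose proof one_lt_inv_ratio.
  unfold pq_nodes_line, pq_nodes_tail.
  destruct (Rlt_dec (q / p) 1); [lra|].
  destruct (Rlt_dec (Rabs (p / q)) 1); [|contradiction].
  f_equal; [|f_equal]; f_equal; lia.
Qed.

Lemma ex_pqint_line_split (h : R -> R) :
  ex_pqint_line p q h <-> ex_pqint0 p q h 1 /\ ex_pqint_tail p q h 1.
Proof.
  unfold ex_pqint_line, ex_bseries, ex_pqint0, ex_pqint_tail.
  split; intros [H1 H2]; (split; [revert H1 | revert H2]);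
    apply ex_series_ext; intros n; cbv beta;
    now rewrite ?pq_nodes_line_pos, ?pq_nodes_line_neg.
Qed.

Lemma pqint_line_split (h : R -> R) :
  pqint_line p q h = pqint0 p q h 1 + pqint_tail p q h 1.
Proof.
  pose proof one_lt_inv_ratio.
  unfold pqint_line, BSeries, pqint0, pqint_tail.
  destruct (Rlt_dec (q / p) 1); [lra|].
  destruct (Rlt_dec (Rabs (p / q)) 1); [|contradiction].
  rewrite Rmult_1_r, <- Rmult_plus_distr_l.
  do 2 f_equal; apply Series_ext; intros k;
    now rewrite ?pq_nodes_line_pos, ?pq_nodes_line_neg.
Qed.

End PQ.

(** * All intervals together, for a contracting ratio *)

Lemma pq_parts_contracting (p q a : R) (b : Rbar) (f g : R -> R) :
  let h1 := fun x => f (p * x) * Dpq p q g x in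
  let h2 := fun x => g (q * x) * Dpq p q f x in
  p <> q -> Rabs (p / q) < 1 -> pq_admissible p q a b ->
  0 <= a -> Rbar_lt (Finite a) b ->
  ex_derive f 0 -> ex_derive g 0 ->
  (b = p_infty -> ex_finite_lim (fun x => f x * g x) p_infty) ->
  (b = p_infty ->
     (ex_pqint p q h1 a b \/ ex_pqint p q h2 a b) /\
     (q / p < 0 -> ex_pqint p q h1 a b /\ ex_pqint p q h2 a b)) ->
  ex_pqint p q h1 a b /\ ex_pqint p q h2 a b /\
  pqint p q h1 a b + pqint p q h2 a b = value_at (fun x => f x * g x) b - f a * g a.
Proof.
  intros h1 h2 Hpq Hr [Hq [_ [Hp Hpos]]] Ha Hab Hf Hg Hlim Hconv.
  assert (Cf := ex_derive_continuous _ _ Hf).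
  assert (Cg := ex_derive_continuous _ _ Hg).
  assert (E1 : forall c, ex_pqint0 p q h1 c) by (intros; now apply ex_pqint0_mult_Dpq).
  assert (E2 : forall c, ex_pqint0 p q h2 c) by (intros; now apply ex_pqint0_mult_Dpq).
  assert (P0 := fun c => pqint0_parts p q Hq Hr f g c Hpq Hf Hg).
  fold h1 h2 in P0.
  destruct b as [b| |]; [| |contradiction].
  - simpl; repeat split; auto.
    (* The boundary values at [0] cancel. *)
    pose proof (P0 a); pose proof (P0 b); lra.
  - destruct (Hlim eq_refl) as [L HL].
    destruct (Hconv eq_refl) as [Hor Hand].
    specialize (Hp eq_refl); specialize (Hpos eq_refl).
    simpl in Hor, Hand |- *.
    rewrite (is_lim_unique _ _ _ HL).
    destruct (Req_EM_T a 0) as [->|Ha0].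
    + specialize (Hpos eq_refl).
      rewrite !ex_pqint_line_split in * by assumption.
      rewrite !pqint_line_split by assumption.
      destruct (pqint_tail_parts p q Hq Hr f g 1 L Hp Hpq Rlt_0_1 HL)
        as [T1 [T2 T]]; [tauto | tauto |].
      fold h1 h2 in T1, T2, T.
      repeat split; auto.
      (* The boundary values at [1] cancel, leaving [L - f 0 * g 0]. *)
      pose proof (P0 1); simpl; lra.
    + destruct (pqint_tail_parts p q Hq Hr f g a L) as [T1 [T2 T]];
        auto; lra.
Qed.

(** * Exchanging [p] and [q] *)

Section Swap.
Variables (p q a : R) (b : Rbar).
Hypothesis hadm : pq_admissible p q a b.
Hypothesis hgt : 1 < Rabs (p / q).

Lemma numerator_neq_0 : p <> 0.
Proof. intros E; rewrite E in hgt; unfold Rdiv in hgt; rewrite Rmult_0_l, Rabs_R0 in hgt; lra. Qed.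

Lemma Rabs_swapped_ratio_lt_1 : Rabs (q / p) < 1.
Proof.
  destruct hadm as [hq _]; pose proof numerator_neq_0 as hp.
  replace (q / p) with (/ (p / q)) by (field; auto).
  rewrite Rabs_inv, <- Rinv_1; apply Rinv_lt_contravar; lra.
Qed.

Lemma pq_admissible_swap : pq_admissible q p a b.
Proof.
  pose proof numerator_neq_0 as hp; pose proof Rabs_swapped_ratio_lt_1.
  destruct hadm as [hq [_ [_ Hpos]]].
  split; [exact hp|]; split; [lra|]; split; [auto|]; intros Hb Ha0.
  replace (p / q) with (/ (q / p)) by (field; auto).
  apply Rinv_0_lt_compat; auto.
Qed.

(** The left side takes its [else] branch and the right side its [then] branch, which coincide after
    renaming. *)
Lemma pq_nodes0_swap : pq_nodes0 p q = pq_nodes0 q p.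
Proof.
  pose proof Rabs_swapped_ratio_lt_1; unfold pq_nodes0.
  destruct (Rlt_dec (Rabs (p / q)) 1), (Rlt_dec (Rabs (q / p)) 1); lra || reflexivity.
Qed.

Lemma pq_nodes_tail_swap : pq_nodes_tail p q = pq_nodes_tail q p.
Proof.
  pose proof Rabs_swapped_ratio_lt_1; unfold pq_nodes_tail.
  destruct (Rlt_dec (Rabs (p / q)) 1), (Rlt_dec (Rabs (q / p)) 1); lra || reflexivity.
Qed.

(** The bilateral integral tests ratios without absolute values; positivity of both ratios settles
    these tests. *)
Lemma line_ratios : b = p_infty -> a = 0 -> q / p < 1 /\ ~ p / q < 1.
Proof.
  intros Hb Ha0; pose proof Rabs_swapped_ratio_lt_1.
  destruct hadm as [_ [_ [_ Hpos]]]; specialize (Hpos Hb Ha0).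
  destruct pq_admissible_swap as [_ [_ [_ Hpos']]]; specialize (Hpos' Hb Ha0).
  rewrite Rabs_pos_eq in * by lra; lra.
Qed.

Lemma ex_pqint_swap (h : R -> R) : ex_pqint p q h a b <-> ex_pqint q p h a b.
Proof.
  unfold ex_pqint, ex_pqint0, ex_pqint_tail, ex_pqint_line.
  rewrite pq_nodes0_swap, pq_nodes_tail_swap.
  pose proof line_ratios as HR.
  destruct b; try tauto.
  destruct (Req_EM_T a 0) as [Ha0|]; [|tauto].
  destruct (HR eq_refl Ha0); unfold pq_nodes_line.
  destruct (Rlt_dec (q / p) 1), (Rlt_dec (p / q) 1); tauto.
Qed.

Lemma pqint_swap (h : R -> R) : pqint p q h a b = pqint q p h a b.
Proof.
  pose proof Rabs_swapped_ratio_lt_1.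
  unfold pqint, pqint0, pqint_tail, pqint_line.
  rewrite pq_nodes0_swap, pq_nodes_tail_swap.
  pose proof line_ratios as HR.
  destruct (Rlt_dec (Rabs (p / q)) 1), (Rlt_dec (Rabs (q / p)) 1); try lra.
  destruct b; try reflexivity.
  destruct (Req_EM_T a 0) as [Ha0|]; [|reflexivity].
  destruct (HR eq_refl Ha0); unfold pq_nodes_line.
  destruct (Rlt_dec (q / p) 1), (Rlt_dec (p / q) 1); reflexivity || contradiction.
Qed.

End Swap.

(** Convergence belongs to the conclusion: [pqint] is total, so the equation alone could relate
    default values. *)
Theorem mainTheorem5 (p q a : R) (b : Rbar) (f g : R -> R)
  (hpq : p <> q)
  (hadm : pq_admissible p q a b)
  (ha : 0 <= a) (hab : Rbar_lt (Finite a) b)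
  (hf : locally 0 (fun x => ex_derive f x))
  (hg : locally 0 (fun x => ex_derive g x))
  (hlim : b = p_infty -> ex_finite_lim (fun x => f x * g x) p_infty)
  (hconv : b = p_infty ->
     (ex_pqint p q (fun x => f (p * x) * Dpq p q g x) a b \/
      ex_pqint p q (fun x => g (q * x) * Dpq p q f x) a b) /\
     (q / p < 0 ->
      ex_pqint p q (fun x => f (p * x) * Dpq p q g x) a b /\
      ex_pqint p q (fun x => g (q * x) * Dpq p q f x) a b)) :
  ex_pqint p q (fun x => f (p * x) * Dpq p q g x) a b /\
  ex_pqint p q (fun x => g (q * x) * Dpq p q f x) a b /\
  pqint p q (fun x => f (p * x) * Dpq p q g x) a b =
    value_at (fun x => f x * g x) b - f a * g a
    - pqint p q (fun x => g (q * x) * Dpq p q f x) a b.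
Proof.
  apply locally_singleton in hf; apply locally_singleton in hg.
  destruct (Rlt_or_le (Rabs (p / q)) 1) as [Hr|Hr].
  - destruct (pq_parts_contracting p q a b f g) as [H1 [H2 H3]]; auto.
    repeat split; auto; lra.
  - assert (Hr' : 1 < Rabs (p / q)) by (destruct hadm as [_ [H1 _]]; lra).
    rewrite !(pqint_swap p q a b hadm Hr'), !(ex_pqint_swap p q a b hadm Hr') in *.
    rewrite !(Dpq_sym p q) in * by exact hpq.
    assert (Hfg : (fun x => f x * g x) = (fun x => g x * f x))
      by (apply functional_extensionality; intros x; apply Rmult_comm).
    rewrite Hfg in *.
    (* For the exchanged data the first integrand is the original second one, so [H1] and [H2] come
       out in the opposite order. *)
    destruct (pq_parts_contracting q p a b g f) as [H1 [H2 H3]]; auto.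
    + now apply Rabs_swapped_ratio_lt_1 with a b.
    + now apply pq_admissible_swap.
    + intros Hb; destruct (hconv Hb) as [Hor Hand]; split; [tauto|].
      intros Hneg; apply and_comm, Hand.
      replace (q / p) with (/ (p / q)) by apply Rinv_div.
      now apply Rinv_lt_0_compat.
    + repeat split; auto; lra.
Qed.
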